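(* Let $n\ge 1$ be an integer and consider $n$ joining pipes $P_1,\dots,P_n$ merging into one pipe $P_0$. Let $p_{j,r},q_{j,\ell},p_{j,\ell},q_{j,r}$ ($j=0,1,\dots,n$) be real-valued functions of time, with $p_{j,r}$ and $q_{j,\ell}$ differentiable, satisfying the individual pipe dynamics $$\dot p_{j,r}=\alpha_j(q_{j,r}-q_{j,\ell}),\qquad \dot q_{j,\ell}=\beta_j p_{j,r}+\kappa_j p_{j,\ell}+\gamma_j q_{j,\ell},\qquad j=0,1,\dots,n,$$ and the matching conditions at the junction $$p_{1,r}=p_{2,r}=\dots=p_{n,r}=p_{0,\ell},\qquad q_{1,r}+q_{2,r}+\dots+q_{n,r}=q_{0,\ell}.$$ Then for every $k\in\{1,2,\dots,n\}$ the internal variable $q_{k,r}$ is expressed through the state variables $q_{j,\ell}$, $j\in\{0,1,\dots,n\}$, by $$\left(\sum_{j=1}^n\prod_{\substack{i=1\\ i\neq j}}^n\alpha_i\right)q_{k,r}=\prod_{\substack{i=1\\ i\neq k}}^n\alpha_i\left(q_{0,\ell}-\sum_{\substack{i=1\\ i\neq k}}^n q_{i,\ell}\right)+\left(\sum_{j=1}^n\prod_{\substack{i=1\\ i\neq j}}^n\alpha_i-\prod_{\substack{i=1\\ i\neq k}}^n\alpha_i\right)q_{k,\ell}.$$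
   Context: For pipe $P_j$, $p_{j,\ell},p_{j,r}$ are the (deviations of) pressures at the left and right ends, and $q_{j,\ell},q_{j,r}$ the (deviations of) mass flows at the left and right ends. The coefficients $\alpha_j,\beta_j,\kappa_j,\gamma_j$ are real constants; in the application $\alpha_j=-\frac{R_sT_0z_0}{A_jX_j}<0$ and $\beta_j=-\frac{A_j}{X_j}<0$, where $R_s,T_0,z_0,A_j,X_j>0$ (specific gas constant, temperature, compressibility factor, cross-sectional area, length). Empty products equal $1$. *)

(* Defs.v *)
From HB Require Import structures.
From mathcomp Require Import all_boot all_order all_algebra.
From mathcomp Require Import all_classical all_reals all_analysis.
Set Implicit Arguments.
Unset Strict Implicit.
Unset Printing Implicit Defensive.
Import Order.TTheory GRing.Theory Num.Theory.
Import numFieldNormedType.Exports.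
Local Open Scope classical_set_scope.
Local Open Scope ring_scope.

(** Differentiability of [f] at [t] with derivative [l], relative to a time
    domain [I]: increments are restricted to those that stay in [I], so that
    the derivative is one-sided at an end point of [I] that belongs to [I], and
    the values of [f] outside [I] are irrelevant (for [t] in [I]). *)
Definition is_derive_within (R : realType) (I : set R) (f : R -> R) (t l : R)
    : Prop :=
  h^-1 * (f (h + t) - f t) @[h --> within [set h | I (h + t)] 0^'] --> l.

(** At an interior point of the domain this is the usual derivative. *)
Lemma is_derive_within_interior (R : realType) (I : set R) (f : R -> R)
    (t l : R) :
  nbhs t I -> is_derive_within I f t l <-> is_derive t 1 f l.
Proof.
move=> It.
have I0 : (0 : R)^' [set h | I (h + t)].
  apply: nbhs_dnbhs.
  have : (h + t @[h --> (0 : R)]) --> t.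
    rewrite -[X in _ --> X]add0r.
    by apply: cvgD; [exact: cvg_id | exact: cvg_cst].
  by move=> /(_ I It).
have E : within [set h | I (h + t)] (0 : R)^' = (0 : R)^'.
  apply/seteqP; split=> A; rewrite /within /=; last by apply: filterS.
  by move=> H; near=> h; apply: (near H h) => //; near: h.
rewrite /is_derive_within E.
have F : (fun h : R => h^-1 * (f (h + t) - f t)) =
         (fun h : R => h^-1 *: (f (h *: (1 : R) + t) - f t)).
  by apply/funext => h; rewrite /GRing.scale /= mulr1.
rewrite F; split=> [H|[H <-]].
  by apply: DeriveDef; [apply/cvg_ex; exists l | exact: cvg_lim H].
exact: H.
Unshelve. all: by end_near.
Qed.

(* Main.v *)
Require Import Defs.
From mathcomp Require Import all_boot all_order all_algebra.
From mathcomp Require Import all_classical all_reals all_analysis.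
From mathcomp Require Import ring lra.
Import Order.TTheory GRing.Theory Num.Theory.
Import numFieldNormedType.Exports.
Local Open Scope classical_set_scope.
Local Open Scope ring_scope.

(* Since [alpha_j (q_{j,r} - q_{j,l})] is the derivative of [p_{j,r}] and all
   [p_{j,r}] with [j <> 0] agree, these products have a common value.  Hence
   [P_j d_k = P_k d_j] with [d_j = q_{j,r} - q_{j,l}] and [P_j] the product of
   the [alpha_i], [i <> 0, j]; summing over [j] and using the flow balance at the
   junction gives the claim, without dividing by any [alpha_i]. *)

(** Moving from [t] a small fraction of the way towards [s] stays in the interval, so admissible
    nonzero increments exist arbitrarily close to [0], even when [t] is an end point of [I]. *)
Lemma within_dnbhs_proper {R : realType} {I : set R} {t s : R} :
  is_interval I -> I t -> I s -> s != t ->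
  ProperFilter (within [set h | I (h + t)] (0 : R)^').
Proof.
move=> hI It Is st; apply: Build_ProperFilter_ex => A.
rewrite /within /= => /nbhs_ballP[e /= e0 eA].
have d0 : 0 < `|s - t| by rewrite normr_gt0 subr_eq0.
(* The cap [1] keeps [c * (s - t) + t] between [t] and [s]; the other bound gives an increment of
   size at most [e / 2], hence strictly inside the ball. *)
pose c := Num.min 1 (e / 2 / `|s - t|).
have c0 : 0 < c by rewrite lt_min ltr01 !divr_gt0.
have c1 : c <= 1 by rewrite ge_min lexx.
have ce : c * `|s - t| < e.
  rewrite (@le_lt_trans _ _ (e / 2)) ?ltr_pdivrMr ?ltr_pMr ?ltr1n//.
  by rewrite -ler_pdivlMr// ge_min lexx orbT.
exists (c * (s - t)); apply: eA => /=.
- by rewrite /ball /= sub0r normrN normrM gtr0_norm.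
- by rewrite mulf_eq0 subr_eq0 negb_or st gt_eqF.
- have [ts|ts] := leP t s.
  + by apply: (hI t s) => //; apply/andP; split; nra.
  + by apply: (hI s t) => //; apply/andP; split; nra.
Qed.

(** The difference quotients of [f] and [g] coincide at every increment that stays in [I], and
    limits along a proper filter in a Hausdorff space are unique. *)
Lemma is_derive_within_unique {R : realType} {I : set R} {f g : R -> R}
    {t s a b : R} :
  is_interval I -> I t -> I s -> s != t ->
  (forall u, I u -> f u = g u) ->
  is_derive_within I f t a -> is_derive_within I g t b -> a = b.
Proof.
move=> hI It Is st fg fa gb.
have PF := within_dnbhs_proper hI It Is st.
apply: (cvg_unique (@norm_hausdorff _ _) fa).
apply: cvg_trans gb; apply: near_eq_cvg.
by apply: filterS (withinT _ _) => h /= Ih; rewrite !fg.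
Qed.

(** For [j != k], the left product contains [alpha k] and the right one [alpha j]; pairing these
    with [d k] and [d j] turns both sides into [c] times the product over the indices other than [j]
    and [k]. *)
Lemma mul_prod_others {R : comNzRingType} {T : finType} (P : pred T)
    {alpha d : T -> R} {c : R} {j k : T} :
  (forall i, P i -> alpha i * d i = c) -> P j -> P k ->
  (\prod_(i | P i && (i != j)) alpha i) * d k =
  (\prod_(i | P i && (i != k)) alpha i) * d j.
Proof.
move=> dc Pj Pk; have [->//|jk] := eqVneq j k.
rewrite (bigD1 k) /=; last by rewrite Pk eq_sym.
rewrite [in RHS](bigD1 j) /=; last by rewrite Pj.
rewrite mulrAC dc// [RHS]mulrAC dc//; congr (_ * _).
by apply: eq_bigl => i; rewrite andbAC.
Qed.

Theorem proposition1 (R : realType) (n : nat) (hn : (1 <= n)%N)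
  (I : set R) (hI : is_interval I)
  (hI2 : exists a b : R, [/\ I a, I b & a < b])
  (alpha beta kappa gamma : 'I_n.+1 -> R)
  (pl pr ql qr : 'I_n.+1 -> R -> R)
  (dyn_p : forall (j : 'I_n.+1) (t : R), I t ->
     is_derive_within I (pr j) t (alpha j * (qr j t - ql j t)))
  (dyn_q : forall (j : 'I_n.+1) (t : R), I t ->
     is_derive_within I (ql j) t
       (beta j * pr j t + kappa j * pl j t + gamma j * ql j t))
  (match_p : forall (j : 'I_n.+1) (t : R), j != ord0 -> I t ->
     pr j t = pl ord0 t)
  (match_q : forall t : R, I t ->
     \sum_(j < n.+1 | j != ord0) qr j t = ql ord0 t) :
  forall (k : 'I_n.+1) (t : R), k != ord0 -> I t ->
    (\sum_(j < n.+1 | j != ord0)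
        \prod_(i < n.+1 | (i != ord0) && (i != j)) alpha i) * qr k t =
    (\prod_(i < n.+1 | (i != ord0) && (i != k)) alpha i) *
      (ql ord0 t - \sum_(i < n.+1 | (i != ord0) && (i != k)) ql i t) +
    (\sum_(j < n.+1 | j != ord0)
        \prod_(i < n.+1 | (i != ord0) && (i != j)) alpha i -
     \prod_(i < n.+1 | (i != ord0) && (i != k)) alpha i) * ql k t.
Proof.
move=> k t k0 It.
have [s Is st] : exists2 s, I s & s != t.
  case: hI2 => a [b [Ia Ib ab]]; have [at_|] := eqVneq a t; last by exists a.
  by exists b => //; rewrite -at_ gt_eqF.
pose d j := qr j t - ql j t.
have dc j : j != ord0 -> alpha j * d j = alpha k * d k.
  move=> j0; apply: (is_derive_within_unique hI It Is st _
    (dyn_p j t It) (dyn_p k t It)) => u Iu.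
  by rewrite !match_p.
(* The flow balance turns [ql ord0 t] into the sum of all [qr j t]; the subtracted sum skips [k],
   which leaves the extra [ql k t]. *)
have sumd : ql ord0 t - \sum_(i < n.+1 | (i != ord0) && (i != k)) ql i t
    = \sum_(j < n.+1 | j != ord0) d j + ql k t.
  by rewrite sumrB match_q// [in RHS](bigD1 k k0) /=; ring.
have key : (\sum_(j < n.+1 | j != ord0)
    \prod_(i < n.+1 | (i != ord0) && (i != j)) alpha i) * d k =
    (\prod_(i < n.+1 | (i != ord0) && (i != k)) alpha i) *
    \sum_(j < n.+1 | j != ord0) d j.
  rewrite mulr_suml mulr_sumr; apply: eq_bigr => j j0.
  exact: (mul_prod_others (fun i => i != ord0) dc j0 k0).
(* The two terms in [ql k t] weighted by the product without [alpha k] cancel, and [d k + ql k t] is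
   [qr k t]. *)
by rewrite sumd mulrDr -key /d; ring.
Qed.
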